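(* Let $E$ be a vector space over $\mathbb{R}$ and let $C\subset E$ be convex, finite-dimensional, and compact. Let $f,g:C\to\mathbb{R}$ be functions with $f$ convex and $g=\sup_{i\in I}g_i$ the pointwise supremum of a finite family $(g_i)_{i\in I}$ of affine functions $g_i:C\to\mathbb{R}$. Assume that $f(x)\le g(x)$ holds for every $x\in C$ satisfying one of the following two conditions: (i) $x$ belongs to the relative boundary of $C$; (ii) $x$ belongs to the relative interior of $C$ and the set of functions $\{g_i : i\in I,\ g_i(x)=g(x)\}$ contains at least $\dim C+1$ affinely independent functions. Then $f\le g$ on $C$.
   Context: $E$ may be infinite-dimensional and carries no a priori topology. The dimension $\dim C$ of a convex set $C\subset E$ is the dimension of the vector subspace $F\subset E$ obtained by translating the affine hull $A$ of $C$ to the origin. If this dimension is finite, $A$ is given the topology obtained by translating from $F$ its usual (unique Hausdorff topological vector space) topology; compactness of $C$ refers to this topology, and the relative boundary and relative interior of $C$ are the boundary and interior of $C$ as a subset of the topological space $A$. A family of functions $(g_i: i\in J)$ ($J$ finite) is affinely independent if $\sum_{i\in J}\alpha_i g_i=0$ with $\alpha_i\in\mathbb{R}$ and $\sum_{i\in J}\alpha_i=0$ implies $\alpha_i=0$ for all $i\in J$. *)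

(* Defs.v *)
From HB Require Import structures.
From mathcomp Require Import all_boot all_order all_algebra.
From mathcomp Require Import all_classical all_reals all_analysis.
Import Order.TTheory GRing.Theory Num.Theory.
Import numFieldNormedType.Exports.

Set Implicit Arguments.
Unset Strict Implicit.
Unset Printing Implicit Defensive.

Local Open Scope classical_set_scope.
Local Open Scope ring_scope.
Local Open Scope convex_scope.

Section affine_geometry.
Context {R : realType} {E : lmodType R}.
Implicit Types (A C V : set E) (a x y v w : E).

Definition affine_set A :=
  forall x y (t : R), A x -> A y -> A (t *: x + (1 - t) *: y).

Definition affine_hull C : set E := smallest affine_set C.

(* For a nonempty affine set A, this is the subspace A - a for any a in A: see
   direction_translate. *)
Definition direction A : set E := [set v | exists2 a, A a & A (a + v)].

Definition lincomb n (b : 'I_n -> E) (u : 'rV[R]_n) : E :=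
  \sum_(i < n) u 0 i *: b i.

Definition is_basis V n (b : 'I_n -> E) :=
  [/\ forall i, V (b i),
      forall u, lincomb b u = 0 -> u = 0
    & forall v, V v -> exists u, v = lincomb b u].

(* C is finite-dimensional and dim C = n; with this reading dim set0 = 0. *)
Definition affine_dim C (n : nat) :=
  exists b : 'I_n -> E, is_basis (direction (affine_hull C)) b.

Lemma affine_set_hull C : affine_set (affine_hull C).
Proof.
by move=> x y t hx hy B BC; apply: BC.1; [exact: hx|exact: hy].
Qed.

Lemma affine_set_shift A a x y :
  affine_set A -> A a -> A x -> A y -> A (a + (y - x)).
Proof.
move=> Aaff Aa Ax Ay.
have Am : A (2^-1 *: a + (1 - 2^-1) *: y) by exact: Aaff.
have := Aaff _ _ 2 Am Ax.
suff -> : 2 *: (2^-1 *: a + (1 - 2^-1) *: y) + (1 - 2) *: x = a + (y - x) by [].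
rewrite scalerDr !scalerA mulfV ?pnatr_eq0// scale1r.
rewrite mulrBr mulfV ?pnatr_eq0// mulr1 (_ : (2 - 1 : R) = 1); last first.
  by rewrite -[2]/(1 + 1) addrK.
rewrite (_ : (1 - 2 : R) = -1) ?scale1r ?scaleN1r ?addrA//.
by rewrite -[2]/(1 + 1) opprD addrA subrr add0r.
Qed.

Lemma direction_translate A a : affine_set A -> A a ->
  direction A = [set v | A (a + v)].
Proof.
move=> Aaff Aa; apply/seteqP; split => v /=; last by exists a.
move=> [x Ax Axv]; have := affine_set_shift Aaff Aa Ax Axv.
by rewrite [x + v]addrC addrK.
Qed.

Lemma affine_set_lincomb A a n (b : 'I_n -> E) u : affine_set A -> A a ->
  (forall i, direction A (b i)) -> A (a + lincomb b u).
Proof.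
move=> Aaff Aa; rewrite (direction_translate Aaff Aa) => Ab.
rewrite /lincomb; elim/big_rec: _ => [|i v _ Av]; first by rewrite addr0.
have Aub : A (a + u 0 i *: b i).
  have := Aaff _ _ (u 0 i) (Ab i) Aa.
  suff -> : u 0 i *: (a + b i) + (1 - u 0 i) *: a = a + u 0 i *: b i by [].
  by rewrite scalerDr scalerBl scale1r addrAC addrC addrCA addrA addrC addrA subrK addrC.
have := affine_set_shift Aaff Aub Aa Av.
by rewrite [a + v]addrC addrK addrA.
Qed.

Definition affine_hull_space C : Type := set_type (affine_hull C).

HB.instance Definition _ C := Choice.on (affine_hull_space C).

(* The charts u |-> a + lincomb b u, with a in the affine hull and b a basis of
   its direction, transport the topology of R^n; any single chart suffices
   (affine_hull_openP).  Without a finite basis the condition is vacuous. *)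
Definition affine_hull_open C : set_system (affine_hull_space C) :=
  [set U | forall a n (b : 'I_n -> E), affine_hull C a ->
     is_basis (direction (affine_hull C)) b ->
     open [set u : 'rV[R]_n | (val @` U) (a + lincomb b u)]].

Section topology.
Variable C : set E.

Let hull_openT : affine_hull_open [set: affine_hull_space C].
Proof.
move=> a n b Aa [bV _ _]; rewrite [X in open X](_ : _ = setT); first exact: openT.
apply/seteqP; split => // u _.
have Au : a + lincomb b u \in affine_hull C.
  by rewrite inE; apply: affine_set_lincomb => //; exact: affine_set_hull.
by exists (SigSub Au).
Qed.

Let hull_openI : setI_closed (@affine_hull_open C).
Proof.
move=> U W oU oW a n b Aa bV.
rewrite [X in open X](_ : _ = [set u | (val @` U) (a + lincomb b u)] `&`
    [set u | (val @` W) (a + lincomb b u)]).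
  exact: openI (oU a n b Aa bV) (oW a n b Aa bV).
apply/seteqP; split => u /=.
  by move=> [y [Uy Wy] <-]; split; exists y.
by move=> [[y Uy <-] [z Wz /val_inj zy]]; exists y => //; split => //; rewrite -zy.
Qed.

Let hull_open_bigU (I : Type) (U : I -> set (affine_hull_space C)) :
  (forall i, affine_hull_open (U i)) -> affine_hull_open (\bigcup_i U i).
Proof.
move=> oU a n b Aa bV.
rewrite [X in open X](_ : _ =
    \bigcup_i [set u | (val @` U i) (a + lincomb b u)]).
  by apply: bigcup_open => i _; exact: oU.
apply/seteqP; split => u /=.
  by move=> [y [i _ Uy] yu]; exists i => //; exists y.
by move=> [i _ [y Uy yu]]; exists y => //; exists i.
Qed.

HB.instance Definition _ := isOpenTopological.Build (affine_hull_space C)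
  hull_openT hull_openI hull_open_bigU.

End topology.

Lemma affine_hull_openP C a n (b : 'I_n -> E) (U : set (affine_hull_space C)) :
  affine_hull C a -> is_basis (direction (affine_hull C)) b ->
  open U <-> open [set u : 'rV[R]_n | (val @` U) (a + lincomb b u)].
Proof.
move=> Aa bV; split => [oU|oU]; first exact: oU.
move=> a' m b' Aa' b'V.
have [bD _ bS] := bV; have [b'D _ _] := b'V.
have Aaff := @affine_set_hull C.
have [c ca] : exists c, a' - a = lincomb b c.
  by apply: bS; rewrite (direction_translate Aaff Aa) /= addrC subrK.
have [M Mb] : exists M : 'I_m -> 'rV[R]_n, forall j, b' j = lincomb b (M j).
  by have [M] := choice (fun j => bS _ (b'D j)); exists M.
pose h (u : 'rV[R]_m) : 'rV[R]_n := \row_i (c 0 i + \sum_j u 0 j * M j 0 i).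
have hE u : a' + lincomb b' u = a + lincomb b (h u).
  rewrite -[a'](subrK a) ca [_ + a]addrC -addrA; congr (_ + _).
  rewrite /lincomb; under [in RHS]eq_bigr => i _ do
    rewrite mxE scalerDl scaler_suml.
  rewrite big_split /=; congr (_ + _).
  rewrite exchange_big; apply: eq_bigr => j _ /=.
  rewrite Mb /lincomb scaler_sumr; apply: eq_bigr => i _.
  by rewrite scalerA.
have hc : continuous h.
  have hi i : continuous (fun u : 'rV[R]_m => c 0 i + \sum_j u 0 j * M j 0 i).
    move=> u; apply: (@cvgD R R^o _ (nbhs u) _ (fun=> c 0 i)); first exact: cvg_cst.
    apply: (@cvg_big R^o _ _ _ _ (@add_continuous R^o)) => j _.
    by apply: (@cvgM R); [exact: coord_continuous|exact: cvg_cst].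
  move=> u B [P PB sPB].
  pose Q i := [set z : 'rV[R]_m | P 0 i (c 0 i + \sum_j z 0 j * M j 0 i)].
  have uQ i : nbhs u (Q i).
    by apply: (hi i u); have := PB 0 i; rewrite mxE.
  have : nbhs u (fun z => forall i, Q i z).
    exact: (@filter_forall _ _ Q (nbhs u) (nbhs_filter u) uQ).
  by apply: filterS => z zQ; apply: sPB => k i; rewrite mxE ord1; exact: zQ.
rewrite [X in open X](_ : _ = h @^-1` [set u | (val @` U) (a + lincomb b u)]).
  by apply: open_comp => // u _; exact: hc.
by apply/seteqP; split => u /=; rewrite hE.
Qed.

Definition in_affine_hull C : set (affine_hull_space C) := val @^-1` C.
Arguments in_affine_hull C _ : clear implicits.

Definition rel_compact C := compact (in_affine_hull C).

Definition rel_interior C : set E := val @` interior (in_affine_hull C).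

Definition rel_boundary C : set E :=
  val @` (closure (in_affine_hull C) `\` interior (in_affine_hull C)).

(* Functions C -> R are represented by functions E -> R, of which only the
   values on C matter. *)
Definition affine_function (C : set (convex_lmodType E))
    (f : convex_lmodType E -> R^o) :=
  forall t : {i01 R},
    {in C &, forall x y : convex_lmodType E, f (x <| t |> y) = f x <| t |> f y}.

Definition affinely_independent (I : finType) C (J : {set I})
    (g : I -> E -> R) :=
  forall alpha : I -> R,
    (forall x, C x -> \sum_(i in J) alpha i * g i x = 0) ->
    \sum_(i in J) alpha i = 0 ->
    forall i, i \in J -> alpha i = 0.

End affine_geometry.

Arguments in_affine_hull {R E} C _.

(* Main.v *)
(* Identify the affine hull with R^n and let [u] be a point of [C] with active
   set A = {i | g_i u = g u}; argue by downward induction on #|A|.  At an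
   interior point where A contains no n+1 affinely independent functions, the
   linear parts of the active g_i all agree on some direction w <> 0.  Follow
   the line u + R w both ways for as long as the active g_i still realise g: by
   compactness this stops on each side, either on the relative boundary or where
   a new g_i becomes active, so f <= g holds at both stopping points.  Between
   them f is convex and g is affine, hence f u <= g u. *)
Require Import Defs.
From HB Require Import structures.
From mathcomp Require Import all_boot all_order all_algebra.
From mathcomp Require Import all_classical all_reals all_analysis.
From mathcomp Require Import ring lra.
Import Order.TTheory GRing.Theory Num.Theory.
Import numFieldNormedType.Exports.

Set Implicit Arguments.
Unset Strict Implicit.
Unset Printing Implicit Defensive.

Local Open Scope classical_set_scope.
Local Open Scope ring_scope.

(** * Convexity and affinity with explicit real weights, and linear parts *)

Lemma convex_setE (R : realType) (V : lmodType R) (S : set V) (t : R)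
    (x y : V) :
  convex_set S -> 0 <= t <= 1 -> S x -> S y -> S (t *: x + (1 - t) *: y).
Proof.
move=> convS /andP[t0 t1] Sx Sy.
by have := convS x y (Itv01 t0 t1) (mem_set Sx) (mem_set Sy); rewrite inE.
Qed.

Lemma affine_functionE (R : realType) (V : lmodType R) (S : set V) (h : V -> R)
    (t : R) (x y : V) :
  affine_function S h -> 0 <= t <= 1 -> S x -> S y ->
  h (t *: x + (1 - t) *: y) = t * h x + (1 - t) * h y.
Proof.
move=> affh /andP[t0 t1] Sx Sy.
exact: (affh (Itv01 t0 t1) x y (mem_set Sx) (mem_set Sy)).
Qed.

Lemma convex_functionE (R : realType) (V : lmodType R) (S : set V) (h : V -> R)
    (t : R) (x y : V) :
  convex_function S h -> 0 <= t <= 1 -> S x -> S y ->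
  h (t *: x + (1 - t) *: y) <= t * h x + (1 - t) * h y.
Proof.
move=> convh /andP[t0 t1] Sx Sy.
exact: (convh (Itv01 t0 t1) x y (mem_set Sx) (mem_set Sy)).
Qed.

(* [D w] is the difference quotient of [h] along [w] at any step [t > 0] keeping
   [x + t *: w] in [S]: by affinity the quotient does not depend on [t]. *)
Lemma affine_linear_part (R : realType) (V : lmodType R) (S : set V) (x : V)
    (h : V -> R) :
  convex_set S -> affine_function S h -> S x ->
  (forall w, \forall t \near (0 : R), S (x + t *: w)) ->
  exists D : V -> R, (forall a v w, D (a *: v + w) = a * D v + D w) /\
    (forall w, S (x + w) -> h (x + w) = h x + D w).
Proof.
move=> convS affh Sx coreS.
pose k w := h (x + w) - h x.
have kE t w : 0 <= t <= 1 -> S (x + w) -> k (t *: w) = t * k w.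
  move=> t01 Sw; rewrite /k.
  have -> : x + t *: w = t *: (x + w) + (1 - t) *: x.
    by rewrite scalerDr scalerBl scale1r addrC -addrA addrCA subrKC addrC.
  by rewrite (affine_functionE affh)//; ring.
have small (w : V) : exists2 t : R, 0 < t & S (x + t *: w).
  have /nbhs_ballP[e /= e0 eS] := coreS w.
  exists (e / 2); first by rewrite divr_gt0.
  by apply: eS; rewrite -ball_normE /= sub0r normrN gtr0_norm; lra.
pose d w := projT1 (cid2 (small w)).
have d0 w : 0 < d w by rewrite /d; case: cid2.
have dS w : S (x + d w *: w) by rewrite /d; case: cid2.
pose D w := k (d w *: w) / d w.
(* The steps [t] and [d w] are compared by shrinking the larger one to the smaller, which [kE]
   allows because the ratio lies in [0, 1]. *)
have DE t w : 0 < t -> S (x + t *: w) -> k (t *: w) = t * D w.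
  have le s u : 0 < s -> s <= u -> S (x + u *: w) ->
      k (s *: w) = s * (k (u *: w) / u).
    move=> s0 su Su; have u0 : 0 < u by apply: lt_le_trans su.
    rewrite -[in LHS](divfK (lt0r_neq0 u0) s) -scalerA kE//.
      by rewrite mulrAC mulrA.
    by apply/andP; split; [rewrite divr_ge0 ?ltW|rewrite ler_pdivrMr// mul1r].
  move=> t0 St; have [td|dt] := leP t (d w); first exact: le.
  have := le _ _ (d0 w) (ltW dt) St => kd.
  by rewrite /D kd; field; rewrite !gt_eqF.
have near2 (P Q : R -> Prop) : (\forall t \near (0 : R), P t) ->
    (\forall t \near (0 : R), Q t) -> exists t : R, [/\ 0 < t, P t & Q t].
  move=> nP nQ; have /nbhs_ballP[e /= e0 eS] : nbhs (0 : R) (P `&` Q).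
    exact: filterI.
  exists (e / 2); have [] : (P `&` Q) (e / 2).
    by apply: eS; rewrite -ball_normE /= sub0r normrN gtr0_norm; lra.
  by split => //; rewrite divr_gt0.
(* The midpoint of [x + t *: v] and [x + t *: w] is [x] moved by [t / 2] along [v + w], so affinity
   at weight 1/2 gives additivity. *)
have DD v w : D (v + w) = D v + D w.
  have [t [t0 Sv Sw]] := near2 _ _ (coreS v) (coreS w).
  have t20 : 0 < t / 2 by rewrite divr_gt0.
  have half : 0 <= (2^-1 : R) <= 1.
    by rewrite invr_ge0 ler0n invf_le1 ?ltr0n ?ler1n.
  have mid : x + (t / 2) *: (v + w) =
      2^-1 *: (x + t *: v) + (1 - 2^-1) *: (x + t *: w).
    have -> : (1 - 2^-1 : R) = 2^-1 by lra.
    have half2 : (2^-1 + 2^-1 : R) = 1 by lra.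
    by rewrite !scalerDr addrACA -scalerDl half2 scale1r !scalerA
      [2^-1 * t]mulrC.
  have Svw : S (x + (t / 2) *: (v + w)) by rewrite mid; exact: convex_setE.
  have := DE _ _ t20 Svw; rewrite /k mid (affine_functionE affh)//.
  have := DE _ _ t0 Sv; have := DE _ _ t0 Sw; rewrite /k.
  move=> /(canRL (subrK _)) -> /(canRL (subrK _)) -> eq.
  by apply: (mulfI (lt0r_neq0 t20)); rewrite -eq; field.
have D0 : D 0 = 0 by apply: (addrI (D 0)); rewrite -DD !addr0.
have DN w : D (- w) = - D w.
  by apply: (addrI (D w)); rewrite -DD !subrr D0.
have DZp a w : 0 < a -> D (a *: w) = a * D w.
  move=> a0; have [t [t0 Sv _]] := near2 _ _ (coreS (a *: w)) (coreS w).
  have := Sv; rewrite scalerA => /(DE _ _ (mulr_gt0 t0 a0)).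
  rewrite -scalerA (DE _ _ t0 Sv) -mulrA.
  by move=> /(mulfI (lt0r_neq0 t0)).
have DZ a w : D (a *: w) = a * D w.
  have [a0|a0|<-] := ltgtP 0 a; last by rewrite scale0r mul0r.
    exact: DZp.
  by rewrite -[a]opprK scaleNr DN DZp ?oppr_gt0// !mulNr.
exists D; split => [a v w|w Sw]; first by rewrite DD DZ.
by have := DE 1 w ltr01; rewrite scale1r mul1r => /(_ Sw) <-; rewrite /k subrKC.
Qed.

(** * Linear algebra of the active linear parts *)

(** Consider the differences [L i - L i0] for [i] in [A]. If they do not span the whole row space,
    some [w != 0] is annihilated by all of them; if they do, [n] of them form a basis, and their
    indices together with [i0] give the affinely independent family. *)
Lemma kernel_or_independent (F : fieldType) (n : nat) (I : finType)
    (L : I -> 'rV[F]_n) (A : {set I}) (i0 : I) : i0 \in A ->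
  (exists2 w : 'rV[F]_n, w != 0 &
     forall i, i \in A -> L i *m w^T = L i0 *m w^T) \/
  (exists J : {set I}, [/\ J \subset A, #|J| = n.+1
     & forall alpha : I -> F, \sum_(i in J) alpha i *: L i = 0 ->
         \sum_(i in J) alpha i = 0 -> forall i, i \in J -> alpha i = 0]).
Proof.
move=> i0A.
(* Indices outside [A] get a zero row, which leaves the span unchanged; rows extracted as
   independent are nonzero, so their indices lie in [A]. *)
pose M : 'M[F]_(#|I|, n) := \matrix_k
  (if enum_val k \in A then L (enum_val k) - L i0 else 0).
have [Mfull|Mnfull] := boolP (row_full M); [right|left]; last first.
  have [w wM w0] : exists2 w : 'rV[F]_n, w *m M^T = 0 & w != 0.
    apply: contrapT => nw; move/negP: Mnfull; apply.
    rewrite -[M]trmxK -/(row_full _) /row_full mxrank_tr -/(row_free _).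
    apply: inj_row_free => v vM; apply: contrapT => v0.
    by apply: nw; exists v => //; apply/eqP.
  exists w => // i iA; apply/eqP; rewrite -subr_eq0 -mulmxBl; apply/eqP.
  have : row (enum_rank i) (M *m w^T) = 0.
    by rewrite -[M *m _]trmxK trmx_mul trmxK wM trmx0 row0.
  by rewrite row_mul rowK enum_rankK iA.
pose e := enum_val \o fullrankfun Mfull.
have e_inj : injective e.
  by move=> k l /enum_val_inj /fullrankfun_inj.
pose N := rowsub (fullrankfun Mfull) M.
have Nfree : row_free N by exact: fullrowsub_free.
have rowN k : row k N = if e k \in A then L (e k) - L i0 else 0.
  by rewrite row_rowsub rowK.
have rowN0 k : row k N != 0.
  apply/eqP => Nk0; have : (delta_mx 0 k : 'rV_n) *m N = 0 *m N.
    by rewrite mul0mx -rowE.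
  move/(row_free_inj Nfree)/rowP/(_ k); rewrite !mxE !eqxx.
  by move/eqP; rewrite oner_eq0.
have eA k : e k \in A.
  by have := rowN0 k; rewrite rowN; case: ifP => //; rewrite eqxx.
(* The row of [i0] is zero as well, so [i0] is not among the [n] extracted indices and adding it
   gives [n.+1]. *)
have i0e : i0 \notin [set e k | k : 'I_n]%SET.
  apply/imsetP => -[k _ i0k]; have := rowN0 k.
  by rewrite rowN eA -i0k subrr eqxx.
exists (i0 |: [set e k | k : 'I_n])%SET; split.
- apply/fintype.subsetP => i; rewrite in_setU1.
  move=> /orP[/eqP ->//|/imsetP[k _ ->]]; exact: eA.
- by rewrite cardsU1 i0e card_imset// card_ord.
move=> alpha; rewrite !big_setU1//= !big_imset /=; try by move=> ? ? _ _ /e_inj.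
move=> aL asum.
(* Since the coefficients sum to zero, [alpha i0] can be eliminated, leaving a vanishing combination
   of the independent rows [L (e k) - L i0]. *)
have ae0 : \row_k alpha (e k) = 0.
  apply: (row_free_inj Nfree); rewrite mul0mx mulmx_sum_row.
  under eq_bigr => k _ do rewrite mxE rowN eA scalerBr.
  have sume : \sum_k alpha (e k) = - alpha i0.
    by apply/eqP; rewrite -addr_eq0 addrC; apply/eqP.
  have sumL : \sum_k alpha (e k) *: L (e k) = - (alpha i0 *: L i0).
    by apply/eqP; rewrite -addr_eq0 addrC; apply/eqP.
  by rewrite sumrB -scaler_suml sume sumL scaleNr subrr.
have aek k : alpha (e k) = 0 by have /rowP/(_ k) := ae0; rewrite !mxE.
move=> i; rewrite in_setU1 => /orP[/eqP ->|/imsetP[k _ ->//]].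
by move: asum; rewrite big1 ?addr0.
Qed.

(** * Following a line until it must stop *)

(** The endpoint is taken at the supremum of the times when the line is in [S] and [G_ i0] is still
    maximal. Compactness of [S] and [w != 0] make this set of times closed and bounded, so the
    supremum is attained. *)
Lemma chord_endpoint (R : realType) (n : nat) (S : set 'rV[R]_n) (I : finType)
    (G_ : I -> 'rV[R]_n -> R) (D : I -> R) (i0 : I) (u w : 'rV[R]_n) :
  compact S -> S u -> w != 0 ->
  (forall i t, S (u + t *: w) -> G_ i (u + t *: w) = G_ i u + t * D i) ->
  (forall i, G_ i u <= G_ i0 u) ->
  (forall i, G_ i u = G_ i0 u -> D i = D i0) ->
  exists2 s : R, 0 <= s & let y := u + s *: w in
    [/\ S y, forall i, G_ i y <= G_ i0 y &
        S^° y -> exists2 i, G_ i y = G_ i0 y & G_ i u != G_ i0 u].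
Proof.
move=> cS Su w0 GD Gle eqD.
pose l (t : R) := u + t *: w.
have lc : continuous l.
  move=> t; apply: cvgD; first exact: cvg_cst.
  by apply: cvgZr_tmp; exact: cvg_id.
(* The gap between [G_ i] and [G_ i0] along the line, extended affinely to all [t] so that it is
   continuous even where the line has left [S]. *)
pose d i (t : R) := G_ i u - G_ i0 u + t * (D i - D i0).
have dc i : continuous (d i).
  move=> t; apply: cvgD; first exact: cvg_cst.
  by apply: cvgM; [exact: cvg_id|exact: cvg_cst].
have dE i t : S (l t) -> (d i t = G_ i (l t) - G_ i0 (l t)).
  by move=> St; rewrite /d !GD//; ring.
pose T := [set t | S (l t) /\ forall i, d i t <= 0].
have T0 : T 0.
  by split=> [|i]; rewrite /l ?scale0r ?addr0// /d mul0r addr0 subr_le0.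
have ubT : has_ubound T.
  have [M [_ MS]] := compact_bounded cS.
  have M1 : M < M + 1 by rewrite ltrDl.
  have {}MS := MS _ M1.
  exists ((M + 1 + `|u|) / `|w|) => t [St _].
  rewrite ler_pdivlMr ?normr_gt0//.
  have := MS _ St => /= lt.
  apply: (@le_trans _ _ `|t *: w|).
    by rewrite normrZ ler_wpM2r// ler_norm.
  have -> : t *: w = l t - u by rewrite /l addrAC subrr add0r.
  by rewrite (le_trans (ler_normB _ _))// lerD2r.
have clT : closed T.
  have -> : T = l @^-1` S `&` \bigcap_i (d i @^-1` [set z | z <= 0]).
    by apply/seteqP; split => t [? dt]; split => // i; [move=> _|]; exact: dt.
  apply: closedI.
    apply: preimage_closed; first by move=> t _; exact: lc.
    by apply: compact_closed => //; exact: norm_hausdorff.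
  by apply: closed_bigI => i _; apply: preimage_closed (@closed_le _ 0) => t _;
    exact: dc.
have Ts : T (sup T) by apply: clT; apply: closure_sup => //; exists 0.
have [Ss ds] := Ts.
exists (sup T); first exact: ub_le_sup.
split => // [i|Sy]; first by rewrite -subr_le0 -dE.
(* If no other [G_ i] catches up with [G_ i0] at the supremum, the chord can be
   prolonged beyond it. *)
apply: contrapT => nex.
(* By [eqD], an index with a different slope is inactive at [u]; a zero gap at the supremum would
   make it newly active, against [nex]. Indices with the same slope keep a constant gap. *)
have dneg i : D i != D i0 -> d i (sup T) < 0.
  move=> Di; rewrite lt_neqAle ds andbT; apply/eqP => di0.
  apply: nex; exists i; first by apply/eqP; rewrite -subr_eq0 -dE// di0.
  by apply/eqP => /eqD /eqP; rewrite (negbTE Di).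
have nearS : \forall t \near sup T, S (l t) := lc (sup T) S Sy.
have neardi i : \forall t \near sup T, d i t <= 0.
  have [DD|/dneg di] := eqVneq (D i) (D i0).
    apply: (@filterE _ _ (nbhs_filter (sup T))) => t.
    by have := ds i; rewrite /d DD subrr !mulr0.
  have := dc i (sup T) _ (lt_nbhsl di).
  by apply: (@filterS _ _ (nbhs_filter (sup T))) => t /= /ltW.
have neard := @filter_forall _ _ (fun i t => d i t <= 0) _
  (nbhs_filter (sup T)) neardi.
have /nbhs_ballP[e /= e0 eT] : nbhs (sup T) T by exact: filterI nearS neard.
have : T (sup T + e / 2).
  by apply: eT; rewrite -ball_normE /= opprD addNKr normrN gtr0_norm; lra.
by move/(ub_le_sup ubT); lra.
Qed.

(** * The inequality in coordinates *)

(** To be applied to the preimage of [C] under an affine chart, where the relative interior becomes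
    the ordinary one. *)
Lemma compact_convex_le (R : realType) (n : nat) (S : set 'rV[R]_n)
    (I : finType) (f g : 'rV[R]_n -> R) (g_ : I -> 'rV[R]_n -> R) :
  convex_set S -> compact S -> convex_function S f ->
  (forall i, affine_function S (g_ i)) ->
  (forall i u, S u -> g_ i u <= g u) ->
  (forall u, S u -> exists i, g_ i u = g u) ->
  (forall u, S u -> ~ S^° u -> f u <= g u) ->
  (forall u, S u -> S^° u ->
    (exists J : {set I}, [/\ forall i, i \in J -> g_ i u = g u,
       (n.+1 <= #|J|)%N & affinely_independent S J g_]) -> f u <= g u) ->
  forall u, S u -> f u <= g u.
Proof.
move=> convS cS convf affg gle gattained le_bd le_int u Su.
pose act u := [set i | g_ i u == g u]%SET.
have [m] := ubnP (#|I| - #|act u|); elim: m u Su => // m IH u Su ltm.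
have [Sou|/le_bd] := pselect (S^° u); last exact.
have coreS w : \forall t \near (0 : R), S (u + t *: w).
  have lc : {for 0, continuous (fun t : R => u + t *: w)}.
    apply: cvgD; first exact: cvg_cst.
    by apply: cvgZr_tmp; exact: cvg_id.
  by apply: lc; rewrite scale0r addr0.
have [D DP] := choice (fun i => affine_linear_part convS (affg i) Su coreS).
have Dlin i a v w : D i (a *: v + w) = a * D i v + D i w.
  by case: (DP i) => -> _.
have gD i w : S (u + w) -> g_ i (u + w) = g_ i u + D i w.
  by case: (DP i) => _; apply.
have D0 i : D i 0 = 0.
  have := Dlin i 1 0 0; rewrite scale1r mul1r addr0 => D00.
  by apply: (addrI (D i 0)); rewrite -D00 addr0.
have DZ i a v : D i (a *: v) = a * D i v.
  by rewrite -[a *: v]addr0 Dlin D0 addr0.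
have DN i v : D i (- v) = - D i v by rewrite -scaleN1r DZ mulN1r.
pose L i : 'rV[R]_n := \row_j D i (delta_mx 0 j).
have DL i w : D i w = (L i *m w^T) 0 0.
  rewrite {1}(row_sum_delta w).
  have -> : D i (\sum_j w 0 j *: delta_mx 0 j) =
      \sum_j w 0 j * D i (delta_mx 0 j).
    by elim/big_rec2: _ => [//|j y z _ <-]; rewrite Dlin.
  by rewrite mxE; apply: eq_bigr => j _; rewrite !mxE mulrC.
have [i0 i0P] := gattained u Su.
have i0A : i0 \in act u by rewrite inE; apply/eqP.
have [[w w0 wL]|[J [JA cJ Jind]]] := kernel_or_independent L i0A; last first.
  apply: (le_int u Su Sou); exists J; split; [|by rewrite cJ|].
    by move=> i /(fintype.subsetP JA); rewrite inE => /eqP.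
  (* A relation among the functions on [S] is evaluated at [u] and at a point of [S] displaced along
     the j-th axis; the difference is the j-th coordinate of the same relation among the rows
     [L i]. *)
  move=> alpha aS asum; apply: Jind => //.
  apply/rowP => j; rewrite mxE summxE.
  have /nbhs_ballP[e /= e0 eS] := coreS (delta_mx 0 j).
  have Se : S (u + (e / 2) *: delta_mx 0 j).
    by apply: eS; rewrite -ball_normE /= sub0r normrN gtr0_norm; lra.
  have := aS _ Se.
  rewrite (eq_bigr (fun i =>
    alpha i * g_ i u + e / 2 * (alpha i * D i (delta_mx 0 j)))).
    2: by move=> i _; rewrite gD// DZ mulrDr [alpha i * (_ * _)]mulrCA.
  rewrite big_split /= aS// add0r -mulr_sumr => /eqP.
  rewrite mulf_eq0 gt_eqF ?divr_gt0//= => /eqP aD; rewrite -[RHS]aD.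
  by apply: eq_bigr => i _; rewrite !mxE.
have eqD i : g_ i u = g_ i0 u -> D i w = D i0 w.
  by rewrite i0P !DL => /eqP gi; rewrite wL ?inE.
(* Stated for a general direction [v] so as to serve both [w] and [- w]. *)
have chord v : v != 0 -> (forall i, g_ i u = g_ i0 u -> D i v = D i0 v) ->
    exists2 s : R, 0 <= s &
      S (u + s *: v) /\ f (u + s *: v) <= g u + s * D i0 v.
  move=> v0 vD.
  have gDv i t : S (u + t *: v) -> g_ i (u + t *: v) = g_ i u + t * D i v.
    by move=> St; rewrite gD// DZ.
  have gle0 i : g_ i u <= g_ i0 u by rewrite i0P gle.
  have [s s0 [Ss sle snew]] := chord_endpoint cS Su v0 gDv gle0 vD.
  exists s => //; split => //; rewrite -i0P -gDv//.
  have gE : g (u + s *: v) = g_ i0 (u + s *: v).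
    have [i gi] := gattained _ Ss.
    by apply/eqP; rewrite eq_le gle// andbT -gi.
  rewrite -gE; have [|/le_bd] := pselect (S^° (u + s *: v)); last exact.
  move=> /snew[i ieq ineq]; apply: IH => //.
  (* Indices active at [u] share the slope of [i0], which still realises [g] at the endpoint, so
     they stay active there; [i] is a new one. *)
  have : act u \proper act (u + s *: v).
    apply/properP; split.
      apply/fintype.subsetP => k; rewrite !inE => /eqP gk.
      by rewrite gE !gDv// gk i0P vD// gk i0P.
    by exists i; rewrite !inE; [rewrite ieq gE|rewrite -i0P].
  move=> /proper_card lt.
  exact: leq_trans (ltn_sub2l (leq_trans lt (max_card _)) lt) ltm.
have [s s0 [Ss fs]] := chord w w0 eqD.
have [||r r0 [Sr fr]] := chord (- w).
- by rewrite oppr_eq0.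
- by move=> i /eqD; rewrite !DN => ->.
(* If neither side allows any movement, [u] is itself an endpoint and [fs] is already the claim. *)
have [sr0|sr0] := eqVneq (s + r) 0.
  have s0' : s = 0 by lra.
  by move: fs; rewrite s0' scale0r mul0r !addr0.
have srp : 0 < s + r by rewrite lt_neqAle eq_sym sr0 addr_ge0.
have r01 : 0 <= r / (s + r) <= 1.
  by apply/andP; split;
    [rewrite divr_ge0// ltW|rewrite ler_pdivrMr// mul1r lerDr].
(* The weights are inverse to the distances from [u], so the displacements cancel; the slope terms
   in the bounds [fs] and [fr] cancel in the same way. *)
have uE : (r / (s + r)) *: (u + s *: w) +
    (1 - r / (s + r)) *: (u + r *: - w) = u.
  rewrite !scalerDr !scalerA addrACA -scalerDl addrC scalerN -scalerBl.
  rewrite [X in X *: w](_ : _ = 0) ?scale0r ?add0r; last by field.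
  by rewrite addrC subrK scale1r.
have := convex_functionE convf r01 Ss Sr; rewrite uE => /le_trans; apply.
have r01' : 0 <= 1 - r / (s + r) by rewrite subr_ge0; case/andP: r01.
case/andP: r01 => r01 _.
apply: (le_trans (lerD (ler_wpM2l r01 fs) (ler_wpM2l r01' fr))).
by rewrite DN le_eqVlt; apply/orP; left; apply/eqP; field.
Qed.

(** * Affine charts of the hull as homeomorphisms *)

Section chart.
Context {R : realType} {E : lmodType R} (C : set E) (a : E) (n : nat)
  (b : 'I_n -> E).
Hypotheses (Ca : affine_hull C a)
  (basisb : is_basis (direction (affine_hull C)) b).

Definition chart (u : 'rV[R]_n) : E := a + lincomb b u.

Lemma lincombD u v : lincomb b (u + v) = lincomb b u + lincomb b v.
Proof.
by rewrite /lincomb -big_split; apply: eq_bigr => i _; rewrite mxE scalerDl.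
Qed.

Lemma lincombZ t u : lincomb b (t *: u) = t *: lincomb b u.
Proof.
by rewrite /lincomb scaler_sumr; apply: eq_bigr => i _; rewrite mxE scalerA.
Qed.

Lemma chart_conv t u v :
  chart (t *: u + (1 - t) *: v) = t *: chart u + (1 - t) *: chart v.
Proof.
rewrite /chart lincombD !lincombZ !scalerDr addrACA -scalerDl.
by rewrite subrKC scale1r.
Qed.

Lemma chart_hull u : affine_hull C (chart u).
Proof.
have [bV _ _] := basisb; apply: affine_set_lincomb => //.
exact: affine_set_hull.
Qed.

Lemma chart_inj : injective chart.
Proof.
move=> u v /addrI uv; have [_ free _] := basisb.
apply/eqP; rewrite -subr_eq0; apply/eqP; apply: free.
by rewrite -scaleN1r lincombD lincombZ scaleN1r uv subrr.
Qed.

Lemma chart_surj x : affine_hull C x -> exists u, chart u = x.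
Proof.
move=> hx; have [_ _ gen] := basisb; have [|u xu] := gen (x - a).
  by rewrite (direction_translate (@affine_set_hull _ _ C) Ca) /= subrKC.
by exists u; rewrite /chart -xu subrKC.
Qed.

(** The chart with values in the type that carries the hull topology; [of_hull] is its inverse, and
    both turn out to be continuous. *)
Definition to_hull (u : 'rV[R]_n) : affine_hull_space C :=
  SigSub (mem_set (chart_hull u)).

Definition of_hull (y : affine_hull_space C) : 'rV[R]_n :=
  projT1 (cid (chart_surj (set_mem (valP y)))).

Lemma chart_of_hull y : chart (of_hull y) = val y.
Proof. by rewrite /of_hull; case: cid. Qed.

Lemma of_hullK : cancel of_hull to_hull.
Proof. by move=> y; apply: val_inj; exact: chart_of_hull. Qed.

Lemma to_hullK : cancel to_hull of_hull.
Proof. by move=> u; apply: chart_inj; rewrite chart_of_hull. Qed.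

Lemma to_hull_continuous : continuous to_hull.
Proof.
apply/continuousP => U /(affine_hull_openP U Ca basisb); congr open.
apply/seteqP; split => u /=; last by exists (to_hull u).
by move=> [y Uy yu]; rewrite (_ : to_hull u = y)//; exact: val_inj.
Qed.

(** By [affine_hull_openP], openness in the hull need only be tested in this one chart, where the
    preimage of [U] under [of_hull] reads as [U] itself. *)
Lemma of_hull_continuous : continuous of_hull.
Proof.
apply/continuousP => U oU; apply/(affine_hull_openP _ Ca basisb).
rewrite (_ : [set u | _] = U)//; apply/seteqP; split => u /=.
  by move=> [y Uy yu]; rewrite (_ : u = of_hull y)//; apply: chart_inj;
    rewrite chart_of_hull.
by move=> Uu; exists (to_hull u) => //=; rewrite to_hullK.
Qed.

Lemma chart_compact : rel_compact C -> compact (chart @^-1` C).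
Proof.
move=> cC; have -> : chart @^-1` C = of_hull @` in_affine_hull C.
  apply/seteqP; split => [u Cu|_ [y Cy <-]] /=; last by rewrite chart_of_hull.
  by exists (to_hull u); [exact: Cu|exact: to_hullK].
apply: continuous_compact => //; apply: continuous_subspaceT.
exact: of_hull_continuous.
Qed.

Lemma chart_interior u : (chart @^-1` C)^° u <-> rel_interior C (chart u).
Proof.
split=> [Cu|[y iy yu]].
  exists (to_hull u) => //=.
  apply: (@filterS _ _ _ (of_hull @^-1` (chart @^-1` C))).
    by move=> y /=; rewrite chart_of_hull.
  by apply: of_hull_continuous; rewrite to_hullK.
have {yu} yu : y = to_hull u by exact: val_inj.
by move: iy; rewrite yu => /(to_hull_continuous (x:=u)).
Qed.

Lemma chart_boundary u : C (chart u) -> ~ (chart @^-1` C)^° u ->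
  rel_boundary C (chart u).
Proof.
move=> Cu nint; exists (to_hull u) => //; split; first exact: subset_closure.
by move=> iu; apply/nint/chart_interior; exists (to_hull u).
Qed.

End chart.

(** * From coordinates back to [C] *)

(** Turns the supremum into an attained maximum. An empty [I] is ruled out because its supremum
    would be minus infinity, whereas [r] is real. *)
Lemma ereal_sup_finite (R : realType) (I : finType) (h : I -> R) (r : R) :
  r%:E = ereal_sup [set (h i)%:E | i in [set: I]] ->
  (forall i, h i <= r) /\ exists i, h i = r.
Proof.
move=> rE; have hr i : h i <= r.
  by rewrite -lee_fin rE; apply: ereal_sup_ubound; exists i.
split => //; have [i0 _|I0] := pickP I; last first.
  move: rE; rewrite (_ : [set _ | _ in _] = set0) ?ereal_sup0//.
  by rewrite -subset0 => z [i]; have := I0 i.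
have [i _ imax] := arg_maxP h (erefl : xpredT i0).
exists i; apply/eqP; rewrite eq_le hr -lee_fin rE.
apply: ge_ereal_sup => _ [j _ <-]; rewrite lee_fin; exact: imax.
Qed.

Theorem lemma2p2 (R : realType) (E : lmodType R) (C : set E) (n : nat)
  (convC : convex_set C) (dimC : affine_dim C n) (compactC : rel_compact C)
  (f g : E -> R) (I : finType) (g_ : I -> E -> R)
  (convf : convex_function C f)
  (affg : forall i, affine_function C (g_ i))
  (supg : forall x, C x ->
    (g x)%:E = ereal_sup [set (g_ i x)%:E | i in [set: I]])
  (le_boundary : forall x, C x -> rel_boundary C x -> f x <= g x)
  (le_interior : forall x, C x -> rel_interior C x ->
    (exists J : {set I},
      [/\ forall i, i \in J -> g_ i x = g x,
          (n.+1 <= #|J|)%N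
        & affinely_independent C J g_]) ->
    f x <= g x) :
  forall x, C x -> f x <= g x.
Proof.
move=> x Cx; have [b basisb] := dimC.
have hullC : C `<=` affine_hull C by move=> y Cy B [_]; exact.
(* Any point of the hull could be the origin of the chart; [x] is at hand. *)
pose phi := chart x b; pose S : set 'rV[R]_n := phi @^-1` C.
have phiconv t u v : phi (t *: u + (1 - t) *: v) =
    t *: phi u + (1 - t) *: phi v by exact: chart_conv.
have [u0 u0x] := chart_surj (hullC _ Cx) basisb (hullC _ Cx).
rewrite -u0x; apply: (@compact_convex_le _ _ S I (f \o phi) (g \o phi)
    (fun i => g_ i \o phi)).
- move=> u v t /set_mem Su /set_mem Sv; apply/mem_set.
  suff: C (phi (t%:num *: u + (1 - t%:num) *: v)) by [].
  by rewrite phiconv; apply: convex_setE => //; apply/andP; split.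
- exact: chart_compact (hullC _ Cx) basisb compactC.
- move=> t u v /set_mem Su /set_mem Sv.
  have := convf t _ _ (mem_set Su) (mem_set Sv); apply: le_trans.
  by rewrite le_eqVlt (congr1 f (phiconv t%:num u v) : (f \o phi) _ = _) eqxx.
- move=> i t u v /set_mem Su /set_mem Sv.
  apply: etrans (affg i t _ _ (mem_set Su) (mem_set Sv)).
  exact: (congr1 (g_ i) (phiconv t%:num u v) : (g_ i \o phi) _ = _).
- by move=> i u Su; case: (ereal_sup_finite (supg _ Su)) => + _; exact.
- by move=> u Su; case: (ereal_sup_finite (supg _ Su)) => _; exact.
- move=> u Su nint; apply: le_boundary => //.
  exact: chart_boundary (hullC _ Cx) basisb _ Su nint.
- move=> u Su uint [J [Jg cJ Jind]]; apply: le_interior => //.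
    exact/(chart_interior (hullC _ Cx) basisb).
  exists J; split => // alpha aC; apply: Jind => v Sv; exact: aC.
- by have : C (chart x b u0) by rewrite u0x.
Qed.
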